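(* Let $n$ be a positive integer and $m'=\prod_{j=1}^t p_j^{\alpha_j}$ with primes $5\le p_1<p_2<\dots<p_t$ and positive integers $\alpha_j$. If $f:\mathbb{Z}_3^n\to\mathbb{Z}_{2m'}$ is a generalized bent function, then $t\ge1$ and $3^n\ge p_1+2$. Moreover, if $n=2$, then for every nonzero $x\in\mathbb{Z}_3^2$, $E_x$ has one of the forms (i) $E_x=D_2(h_1+h_2)+D_5h_3$, or (ii) $E_x=D_2h_1+D_7h_2$, for some $h_1,h_2,h_3\in C_{2m'}$.
   Context: A function $f:G\to\mathbb{Z}_m$ on a finite abelian group $G$ is a generalized bent function if $\left|\sum_{x\in G}\zeta_m^{f(x)}\chi(x)\right|^2=|G|$ for every character $\chi$ of $G$, where $\zeta_m$ is a primitive $m$-th root of unity. $C_{2m'}$ is the multiplicative cyclic group of order $2m'$ with generator $g$; $E_x=\sum_{y}g^{f(x+y)-f(y)}\in\mathbb{Z}[C_{2m'}]$ (sum over $y\in\mathbb{Z}_3^n$). For $d\mid 2m'$, $D_d=\sum_{h\in H_d}h$ where $H_d$ is the unique subgroup of $C_{2m'}$ of order $d$. *)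

(* Defs.v *)
From HB Require Import structures.
From mathcomp Require Import all_boot all_order all_algebra.
From mathcomp Require Import all_fingroup all_solvable all_field all_character.

Set Implicit Arguments.
Unset Strict Implicit.
Unset Printing Implicit Defensive.

Import Order.TTheory GRing.Theory Num.Theory.
Local Open Scope ring_scope.

(* The characters of the finite abelian group (G, +) are the linear characters
   of [set: G] in its additive finGroupType structure. Beware that 'Z_m is Z/m
   only for 1 < m; zeta is meant to be a primitive m-th root of unity. *)
Definition generalized_bent (G : finZmodType) (m : nat) (zeta : algC)
    (f : G -> 'Z_m) : Prop :=
  forall chi : 'CF([set: G]), chi \is a linear_char ->
    `|\sum_(x : G) zeta ^+ f x * chi x| ^+ 2 = #|G|%:R.

(* The integral group ring Z[gT]: an element is its coefficient function, and
   the product is convolution. *)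
Definition group_ringZ (gT : finGroupType) : Type := {ffun gT -> int}.

HB.instance Definition _ (gT : finGroupType) :=
  GRing.Zmodule.on (group_ringZ gT).

Definition gr_elt (gT : finGroupType) (h : gT) : group_ringZ gT :=
  [ffun k => (k == h)%:R].

Definition gr_mul (gT : finGroupType) (a b : group_ringZ gT) : group_ringZ gT :=
  [ffun k => \sum_(h : gT) a h * b (h^-1 * k)%g].

Lemma gr_mulA (gT : finGroupType) : associative (@gr_mul gT).
Proof.
move=> a b c; apply/ffunP=> k; rewrite !ffunE.
under eq_bigr do rewrite ffunE mulr_sumr.
under [RHS]eq_bigr do rewrite ffunE mulr_suml.
rewrite [RHS]exchange_big /=; apply: eq_bigr => h _.
rewrite [RHS](reindex_inj (mulgI h)) /=; apply: eq_bigr => l _.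
by rewrite mulrA mulKg invMg mulgA.
Qed.

Lemma gr_mul1l (gT : finGroupType) : left_id (gr_elt 1%g) (@gr_mul gT).
Proof.
move=> a; apply/ffunP=> k; rewrite ffunE (bigD1 1%g) //= ffunE eqxx mul1r.
rewrite invg1 mul1g big1 ?addr0 // => h /negbTE hn1.
by rewrite ffunE hn1 mul0r.
Qed.

Lemma gr_mul1r (gT : finGroupType) : right_id (gr_elt 1%g) (@gr_mul gT).
Proof.
move=> a; apply/ffunP=> k; rewrite ffunE (bigD1 k) //= ffunE mulVg eqxx mulr1.
rewrite big1 ?addr0 // => h hk; rewrite ffunE -eq_mulVg1 (negbTE hk).
by rewrite mulr0.
Qed.

Lemma gr_mulDl (gT : finGroupType) : left_distributive (@gr_mul gT) +%R.
Proof.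
move=> a b c; apply/ffunP=> k; rewrite !ffunE -big_split /=.
by apply: eq_bigr => h _; rewrite ffunE mulrDl.
Qed.

Lemma gr_mulDr (gT : finGroupType) : right_distributive (@gr_mul gT) +%R.
Proof.
move=> a b c; apply/ffunP=> k; rewrite !ffunE -big_split /=.
by apply: eq_bigr => h _; rewrite ffunE mulrDr.
Qed.

Lemma gr_elt1_neq0 (gT : finGroupType) :
  gr_elt (1%g : gT) != 0 :> group_ringZ gT.
Proof. by apply/eqP=> /ffunP/(_ 1%g); rewrite !ffunE eqxx. Qed.

HB.instance Definition _ (gT : finGroupType) :=
  GRing.Zmodule_isNzRing.Build (group_ringZ gT)
    (@gr_mulA gT) (@gr_mul1l gT) (@gr_mul1r gT)
    (@gr_mulDl gT) (@gr_mulDr gT) (gr_elt1_neq0 gT).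

(* In a cyclic group gT with d %| #|gT| this is the unique subgroup of order d
   (see subgroup_of_orderP); it is the trivial group when no subgroup has
   order d. *)
Definition subgroup_of_order (gT : finGroupType) (d : nat) : {group gT} :=
  odflt 1%G [pick H : {group gT} | #|H| == d].

Lemma subgroup_of_orderP (gT : finGroupType) (d : nat) (H : {group gT}) :
  cyclic [set: gT] -> (d %| #|gT|)%N ->
  (#|H| == d) = (H == subgroup_of_order gT d).
Proof.
move=> /cyclicP[a aT] d_dv; have oa : #[a]%g = #|gT| by rewrite orderE -aT cardsT.
have U (K : {group gT}) : (#|K| == d) = (K == <[(a ^+ (#[a] %/ d))%g]>%G).
  have := cycle_sub_group (_ : (d %| #[a]%g)%N); rewrite oa => /(_ d_dv)/setP/(_ K).
  by rewrite !inE -aT subsetT.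
rewrite U /subgroup_of_order; case: pickP => [K|/(_ <[(a ^+ (#[a] %/ d))%g]>%G)].
  by rewrite U => /eqP ->.
by rewrite U eqxx.
Qed.

Definition D_ (gT : finGroupType) (d : nat) : group_ringZ gT :=
  \sum_(h in subgroup_of_order gT d) gr_elt h.

(* The exponent is the representative in [0, m) of the difference in 'Z_m; it
   gives the intended power of g when g has order m > 1. *)
Definition E_ (gT : finGroupType) (g : gT) (n m : nat)
    (f : 'rV['Z_3]_n -> 'Z_m) (x : 'rV['Z_3]_n) : group_ringZ gT :=
  \sum_(y : 'rV['Z_3]_n) gr_elt (g ^+ (f (x + y) - f y)%R)%g.

(* Main.v *)
Require Import Defs.
From HB Require Import structures.
From mathcomp Require Import all_boot all_order all_algebra.
From mathcomp Require Import all_fingroup all_solvable all_field all_character.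
From mathcomp Require Import zify.

Set Implicit Arguments.
Unset Strict Implicit.
Unset Printing Implicit Defensive.

Import Order.TTheory GRing.Theory Num.Theory.
Local Open Scope ring_scope.

(** Fourier inversion turns bentness into the vanishing of
    [sum_y zeta^(f(x+y) - f(y))] for [x != 0], a sum of [3^n] roots of unity of
    order dividing [2m'].  Cancelling antipodal pairs turns it into a vanishing
    sum of [b h * phi h] over the cyclic group H of order m', where b takes
    integer values; its weight is the sum of [|b h|].

    Let K be of prime index p in H.  Applying the Galois automorphisms
    [z |-> z^(1 + s|K|)] and inverting a Fourier transform on H / K shows that the
    sums over the cosets of K vanish when p divides |K|, and otherwise agree after
    translation into K by the subgroup P of order p.  In the latter case a weight
    less than p leaves some coset empty, so all coset sums vanish; hence a nonzero
    b has weight at least the least prime divisor of |H|.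

    If H has order prime to 6 and the weight is odd and at most 9, take p to be
    the largest prime divisor of |H|.  If the coset sums vanish, one coset has odd
    weight at least 5 and the others have weight at most 4, hence are empty.  If
    they do not, no coset is empty, some coset has weight 1, and the minimal
    weight bound forces all the others to be translates of it, so b is, up to sign,
    the indicator of a coset of P, and p is 5 or 7. *)

(** * Finite sums of natural numbers and integer arithmetic *)

(** Removes one point from a multiset with multiplicities [F]; this is how the elements [h1] and
    [h2] of the final forms are extracted. *)
Lemma sum_nat_succ (T : finType) (F : T -> nat) (n : nat) :
  (\sum_i F i)%N = n.+1 ->
  exists i (F' : T -> nat), (\sum_j F' j)%N = n /\
    forall j, F j = ((j == i) + F' j)%N.
Proof.
move=> sumF; have /existsP[i Fi] : [exists i, F i != 0%N].
  rewrite -negb_forall; apply/negP => /forallP F0.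
  by move: sumF; rewrite big1 // => i _; apply/eqP.
have FE j : F j = ((j == i) + (F j - (j == i)))%N.
  by rewrite subnKC //; case: eqP => // ->; rewrite lt0n.
have S1 : (\sum_j (j == i) = 1)%N.
  by rewrite (bigD1 i) //= eqxx big1 // => j /negbTE ->.
exists i, (fun j => F j - (j == i))%N; split=> //; apply: succn_inj.
rewrite -sumF [RHS](eq_bigr _ (fun j _ => FE j)) big_split /=.
by rewrite S1.
Qed.

Lemma sum_nat_odd_exists (T : finType) (A : {set T}) (F : T -> nat) :
  odd (\sum_(i in A) F i) -> exists2 i, i \in A & odd (F i).
Proof.
rewrite (big_morph odd oddD (erefl _)) => odd_sum.
apply/exists_inP; apply: contraLR odd_sum => /exists_inPn ev.
by rewrite big1 // => i /ev /negbTE.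
Qed.

Lemma sum_nat_eq1_exists (T : finType) (A : {set T}) (F : T -> nat) :
  (\sum_(i in A) F i)%N = 1%N ->
  exists2 i, i \in A & F i = 1%N /\ forall j, j \in A -> j != i -> F j = 0%N.
Proof.
move=> sum1; have [i Ai Fi] : exists2 i, i \in A & odd (F i).
  by apply: sum_nat_odd_exists; rewrite sum1.
exists i => //; move: sum1; rewrite (bigD1 i) //=.
case: (F i) Fi => [|[|m]] // _ [/eqP]; rewrite sum_nat_eq0 => /forall_inP F0.
by split=> // j Aj ji; apply/eqP/F0; rewrite Aj.
Qed.

Lemma leq_abszB (u v : int) : (`|u - v| <= `|u| + `|v|)%N.
Proof. lia. Qed.

(** This lemma and the next three recover the multiplicities [u], [v] at a point and its antipode
    from their minimum, when they differ by at most one in a known direction. *)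
Lemma minn_pos_l (u v : nat) (d : bool) :
  u%:Z - v%:Z = d%:R -> u = (minn u v + d)%N.
Proof. by case: d; lia. Qed.

Lemma minn_pos_r (u v : nat) (d : bool) : u%:Z - v%:Z = d%:R -> v = minn u v.
Proof. by case: d; lia. Qed.

Lemma minn_neg_l (u v : nat) (d : bool) : u%:Z - v%:Z = -1 * d%:R -> u = minn u v.
Proof. by case: d; lia. Qed.

Lemma minn_neg_r (u v : nat) (d : bool) :
  u%:Z - v%:Z = -1 * d%:R -> v = (minn u v + d)%N.
Proof. by case: d; lia. Qed.

Lemma addn_absz_minn (u v : nat) :
  (u + v = `|u%:Z - v%:Z| + 2 * minn u v)%N.
Proof. lia. Qed.

Lemma sum_root_of_unity (p : nat) (z : algC) :
  z ^+ p = 1 -> \sum_(s < p) z ^+ s = if z == 1 then p%:R else 0.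
Proof.
move=> zp; have [->|z1] := eqVneq z 1.
  by rewrite (eq_bigr (fun=> 1)) ?sumr_const ?card_ord // => s _; rewrite expr1n.
by apply: (mulfI (x := z - 1)); rewrite ?subr_eq0 // -subrX1 zp subrr mulr0.
Qed.

(** * Coefficients in the group ring *)

Lemma D_E (gT : finGroupType) (d : nat) (k : gT) :
  D_ gT d k = (k \in subgroup_of_order gT d)%:R.
Proof.
rewrite /D_ sum_ffunE; under eq_bigr do rewrite ffunE.
have [Sk | Sk] := boolP (k \in _).
  rewrite (bigD1 k) //= eqxx big1 ?addr0 // => h /andP[_ /negbTE hk].
  by rewrite eq_sym hk.
by rewrite big1 // => h Sh; case: eqP Sk => // ->; rewrite Sh.
Qed.

Lemma gr_mul_eltE (gT : finGroupType) (a : group_ringZ gT) (h k : gT) :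
  (a * gr_elt h) k = a (k * h^-1)%g.
Proof.
rewrite ffunE (bigD1 (k * h^-1)%g) //= ffunE invMg invgK mulgKV eqxx mulr1.
rewrite big1 ?addr0 // => u uk; rewrite ffunE; case: eqP; rewrite ?mulr0 // => uE.
by rewrite -uE invMg invgK mulKVg eqxx in uk.
Qed.

(** * Vanishing sums under a faithful character of a cyclic group *)

Section VanishingSums.

Variables (gT : finGroupType) (phi : gT -> algC).
Hypothesis cycT : cyclic [set: gT].
Hypothesis phi1 : phi 1%g = 1.
Hypothesis phiM : {morph phi : x y / (x * y)%g >-> x * y}.
Hypothesis phi_inj : injective phi.

Implicit Types (H K P Q : {group gT}) (b : gT -> int).

Let phiX x n : phi (x ^+ n)%g = phi x ^+ n.
Proof. by elim: n => [|n IHn]; rewrite ?phi1 // expgS exprS phiM IHn. Qed.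

Let phi_neq0 x : phi x != 0.
Proof.
apply/eqP=> x0; have /eqP := phi1.
by rewrite -(mulgV x) phiM x0 mul0r eq_sym oner_eq0.
Qed.

Let cT (x y : gT) : (x * y = y * x)%g.
Proof. by apply: (centsP (cyclic_abelian cycT)); rewrite inE. Qed.

Lemma mem_group_expg_card K h : (h ^+ #|K| = 1)%g -> h \in K.
Proof.
move/eqP; rewrite -order_dvdn orderE => oh.
by rewrite -cycle_subG -(cardSg_cyclic cycT) ?subsetT.
Qed.

(** The values of [phi] on [H] are roots of unity of order dividing [#|H|], so some field
    automorphism raises them all to the power [k], and it fixes the integers [b h]. *)
Lemma vanishing_sum_conj H b k :
  coprime k #|H| -> \sum_(h in H) (b h)%:~R * phi h = 0 ->
  \sum_(h in H) (b h)%:~R * phi h ^+ k = 0.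
Proof.
move=> /Qn_aut_exists[u uE] /(congr1 u); rewrite rmorph0 rmorph_sum => {2}<-.
apply: eq_bigr => h Hh; rewrite rmorphM /= rmorph_int uE //.
by rewrite -phiX expg_cardG.
Qed.

(** * Sums over the cosets of a subgroup of prime index *)

Section Fibers.

Variables (H K : {group gT}) (p : nat) (b : gT -> int).
Hypotheses (sKH : K \subset H) (oH : #|H| = (p * #|K|)%N).

(* Fourier inversion on H / K. *)
Lemma fiber_sumE c : c \in H ->
  p%:R * (\sum_(k in K) (b (c * k)%g)%:~R * phi (c * k)%g)
  = \sum_(s < p) (phi c)^-1 ^+ (s * #|K|) *
      (\sum_(h in H) (b h)%:~R * phi h ^+ (1 + s * #|K|)).
Proof.
move=> Hc; transitivity (\sum_(h in H | (c^-1 * h)%g \in K)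
    p%:R * ((b h)%:~R * phi h)).
  rewrite -mulr_sumr; congr (_ * _).
  rewrite [RHS](reindex_inj (mulgI c)) /=; apply: eq_bigl => k.
  rewrite mulKg groupMl //; case Kk: (k \in K); rewrite ?andbF // andbT.
  by rewrite (subsetP sKH).
under [RHS]eq_bigr do rewrite mulr_sumr.
rewrite exchange_big /= big_mkcondr /=; apply: eq_bigr => h Hh.
(* [z] is a [p]-th root of unity, equal to 1 exactly when [h] lies in the coset of [c], so the
   geometric sum in [z] selects that coset. *)
pose z := phi (c^-1 * h)%g ^+ #|K|.
have phiV : (phi c)^-1 = phi c^-1%g.
  by apply: (mulfI (phi_neq0 c)); rewrite divff // -phiM mulgV phi1.
rewrite (eq_bigr (fun s : 'I_p => (b h)%:~R * phi h * z ^+ s)); last first.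
  move=> s _; rewrite exprD expr1 mulrCA -!mulrA; congr (_ * _).
  by rewrite mulrCA; congr (_ * _); rewrite /z -exprM mulnC phiM exprMn phiV.
rewrite -mulr_sumr sum_root_of_unity; last first.
  by rewrite /z -exprM -phiX mulnC -oH expg_cardG ?phi1 ?groupM ?groupV.
have -> : (z == 1) = ((c^-1 * h)%g \in K); last first.
  by case: ifP; rewrite ?mulr0 // mulrC.
apply/eqP/idP => [|Kch]; rewrite /z -phiX.
  by rewrite -phi1 => /phi_inj /mem_group_expg_card.
by rewrite expg_cardG ?phi1.
Qed.

Hypotheses (p_prime : prime p).
Hypothesis b0 : \sum_(h in H) (b h)%:~R * phi h = 0.

Let p_neq0 : p%:R != 0 :> algC.
Proof. by rewrite pnatr_eq0 -lt0n prime_gt0. Qed.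

(** The exponent is always prime to [#|K|], so [p] is the only possible obstruction to its being
    prime to [#|H|]. *)
Let twist0 s : ~~ (p %| 1 + s * #|K|)%N ->
  \sum_(h in H) (b h)%:~R * phi h ^+ (1 + s * #|K|) = 0.
Proof.
move=> ps; apply: vanishing_sum_conj => //.
rewrite oH coprimeMr coprime_sym prime_coprime // ps /=.
by rewrite /coprime addnC gcdnC gcdnMDl gcdn1.
Qed.

Lemma fiber_sum_phi c :
  \sum_(k in K) (b (c * k)%g)%:~R * phi (c * k)%g
  = phi c * (\sum_(k in K) (b (c * k)%g)%:~R * phi k).
Proof. by rewrite mulr_sumr; apply: eq_bigr => k _; rewrite phiM mulrCA. Qed.

Lemma fiber_sum_eq0 c : (p %| #|K|)%N -> c \in H ->
  \sum_(k in K) (b (c * k)%g)%:~R * phi k = 0.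
Proof.
move=> pK Hc; apply: (mulfI (phi_neq0 c)); rewrite -fiber_sum_phi mulr0.
apply: (mulfI p_neq0); rewrite fiber_sumE // mulr0 big1 // => s _.
by rewrite twist0 ?mulr0 // dvdn_addl ?dvdn_mull // dvdn1 gtn_eqF ?prime_gt1.
Qed.

(** As [#|K|] is invertible mod [p], exactly one [s0 < p] makes [p] divide [1 + s0 * #|K|], and only
    its term survives the inversion. Its dependence on [c] is a power of [phi c] with exponent
    divisible by [p], which is 1 when [c ^+ p = 1]. *)
Lemma fiber_sum_const : ~~ (p %| #|K|)%N ->
  exists v, forall c, c \in H -> (c ^+ p = 1)%g ->
    \sum_(k in K) (b (c * k)%g)%:~R * phi k = v.
Proof.
move=> pK; have p_gt0 := prime_gt0 p_prime.
have [s0 ps0 s0U] : exists2 s0 : 'I_p, (p %| 1 + s0 * #|K|)%N &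
    forall s : 'I_p, (p %| 1 + s * #|K|)%N -> s = s0.
  have coK : coprime p #|K| by rewrite prime_coprime.
  have mulK_inj (s a : nat) : (s < p)%N -> (a <= s)%N ->
      s * #|K| == a * #|K| %[mod p] -> s = a.
    move=> ltsp le_as; rewrite eqn_mod_dvd ?leq_mul2r ?le_as ?orbT //.
    rewrite -mulnBl Gauss_dvdl // => psa; apply/eqP.
    rewrite eqn_leq le_as andbT -subn_eq0; apply: contraLR psa => sa0.
    by rewrite gtnNdvd ?lt0n // (leq_ltn_trans (leq_subr _ _)).
  have [a ltap] := Bezoutl #|K| p_gt0; rewrite (eqP coK) => pa.
  exists (Ordinal ltap) => // s ps; apply: val_inj => /=.
  have: s * #|K| == a * #|K| %[mod p].
    by rewrite -(eqn_modDl 1) (eqP ps) (eqP pa).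
  case/orP: (leq_total a s) => le; first exact: mulK_inj.
  by rewrite eq_sym => /mulK_inj->.
exists (p%:R^-1 * \sum_(h in H) (b h)%:~R * phi h ^+ (1 + s0 * #|K|)) => c Hc cp.
apply: (mulfI (phi_neq0 c)); rewrite -fiber_sum_phi.
apply: (mulfI p_neq0); rewrite fiber_sumE // (bigD1 s0) //=.
rewrite [X in _ + X]big1 ?addr0; last first.
  by move=> s s_s0; rewrite twist0 ?mulr0 //; apply: contra s_s0 => /s0U ->.
rewrite [RHS]mulrCA mulVKf //; congr (_ * _).
(* What remains is [phi c ^+ (1 + s0 * #|K|) = 1]. *)
apply: (mulIf (expf_neq0 (s0 * #|K|) (phi_neq0 c))).
rewrite -exprMn mulVf // expr1n -exprS -phiX.
by case/dvdnP: ps0 => q; rewrite add1n => ->; rewrite mulnC expgM cp expg1n phi1.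
Qed.

End Fibers.

(** * Transversals and the dichotomy for coset sums *)

(** The cardinality together with distinctness modulo [K] forces every coset to be met. This form
    applies equally to a chosen set of representatives and to a subgroup complementing [K]. *)
Definition transversal_of H K (X : {set gT}) : Prop :=
  [/\ X \subset H, (#|X| * #|K|)%N = #|H| &
      forall c c', c \in X -> c' \in X -> (c^-1 * c')%g \in K -> c = c'].

Section Transversals.

Variables (H K : {group gT}) (X : {set gT}).
Hypotheses (sKH : K \subset H) (trX : transversal_of H K X).

Let mul_inj : {in setX X K &, injective (fun u : gT * gT => u.1 * u.2)%g}.
Proof.
case: trX => _ _ injX [c k] [c' k'] /setXP[/= Xc Kk] /setXP[/= Xc' Kk'] eq_ck.
have cc' : c = c'.
  apply: injX => //; rewrite (_ : (c^-1 * c' = k * k'^-1)%g) ?groupM ?groupV //.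
  by apply: (mulgI c); rewrite mulKVg mulgA eq_ck mulgK.
by rewrite cc' in eq_ck *; congr (_, _); apply: mulgI eq_ck.
Qed.

Let mul_im : [set (u.1 * u.2)%g | u in setX X K] = H.
Proof.
case: trX => sXH oH _; apply/eqP; rewrite eqEcard (card_in_imset mul_inj).
rewrite cardsX oH leqnn andbT; apply/subsetP=> h /imsetP[[c k] /setXP[Xc Kk] ->].
by apply: groupM; [apply: (subsetP sXH) | apply: (subsetP sKH)].
Qed.

Lemma transversalE h : h \in H ->
  exists c k, [/\ c \in X, k \in K & h = (c * k)%g].
Proof.
by rewrite -mul_im => /imsetP[[c k] /setXP[Xc Kk] ->]; exists c, k.
Qed.

Lemma sum_transversal (F : gT -> nat) :
  (\sum_(h in H) F h = \sum_(c in X) \sum_(k in K) F (c * k)%g)%N.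
Proof.
rewrite -mul_im (big_imset _ mul_inj) /= pair_big_dep /=.
by apply: eq_bigl => -[c k]; rewrite !inE.
Qed.

Lemma leq_fiber_sum (F : gT -> nat) c : c \in X ->
  (\sum_(k in K) F (c * k)%g <= \sum_(h in H) F h)%N.
Proof. by move=> Xc; rewrite sum_transversal [leqRHS](bigD1 c) //= leq_addr. Qed.

End Transversals.

Lemma transversal_of_exists H K : K \subset H -> exists X, transversal_of H K X.
Proof.
move=> sKH; have partKH := rcosets_partition sKH.
have trX := transversalP partKH.
exists (transversal (rcosets K H) H); split.
- exact: transversal_sub trX.
- by rewrite (card_transversal trX) mulnC Lagrange.
- move=> c c' Xc Xc' Kcc'; apply: (pblock_inj trX) => //.
  have sub := subsetP (transversal_sub trX).
  have pb d : d \in H -> pblock (rcosets K H) d = (K :* d)%g.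
    move=> Hd; apply: def_pblock; rewrite ?rcoset_refl //.
      by case/and3P: partKH.
    by apply/rcosetsP; exists d.
  rewrite !pb ?sub //; apply: rcoset_eqP.
  by rewrite mem_rcoset -groupV invMg invgK cT.
Qed.

Lemma cyclic_subgroup_exists H d : (d %| #|H|)%N ->
  exists2 K : {group gT}, K \subset H & #|K| = d.
Proof.
have /cyclicP[a defH] := cyclicS (subsetT H) cycT.
have oH : #|H| = #[a]%g by rewrite defH.
rewrite oH => dvd; exists <[(a ^+ (#[a]%g %/ d))%g]>%G; first by rewrite defH cycleX.
by rewrite -[LHS]orderE orderXdiv ?divnA ?dvdn_div ?mulKn.
Qed.

(** When [p] does not divide [#|K|], the subgroup [P] of order [p] meets [K] trivially, hence is a
    transversal; all its elements satisfy [c ^+ p = 1], so they share one fiber sum [v]. *)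
Lemma fiber_sum_cases H K p b :
    prime p -> K \subset H -> #|H| = (p * #|K|)%N ->
    \sum_(h in H) (b h)%:~R * phi h = 0 ->
  (exists2 X, transversal_of H K X &
     forall c, c \in X -> \sum_(k in K) (b (c * k)%g)%:~R * phi k = 0) \/
  (exists P : {group gT}, exists v : algC,
     [/\ #|P| = p, ~~ (p %| #|K|)%N, transversal_of H K P &
         forall c, c \in P -> \sum_(k in K) (b (c * k)%g)%:~R * phi k = v]).
Proof.
move=> p_pr sKH oH b0; have [pK | pK] := boolP (p %| #|K|)%N.
  left; have [X trX] := transversal_of_exists sKH; exists X => // c Xc.
  by apply: (fiber_sum_eq0 sKH oH) => //; case: trX => /subsetP->.
right; have [v vE] := fiber_sum_const sKH oH p_pr b0 pK.
have [P sPH oP] : exists2 P : {group gT}, P \subset H & #|P| = p.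
  by apply: cyclic_subgroup_exists; rewrite oH dvdn_mulr.
have Pp c : c \in P -> (c ^+ p = 1)%g by move=> Pc; rewrite -oP expg_cardG.
exists P, v; split=> // [|c Pc]; last by rewrite vE ?(subsetP sPH) ?Pp.
split=> // [|c c' Pc Pc' Kcc']; first by rewrite oP.
have tiPK : P :&: K = 1%g by apply: coprime_TIg; rewrite oP prime_coprime.
by apply/eqP; rewrite eq_mulVg1 -in_set1 -set1gE -tiPK inE Kcc' groupM ?groupV.
Qed.

(** * Minimal weight, and classification of odd weight at most 9 *)

(** Induction on [#|H|]. Each fiber inherits the bound: its weight is at most the total, and primes
    dividing [#|K|] divide [#|H|]. *)
Lemma vanishing_sum_small H b :
    \sum_(h in H) (b h)%:~R * phi h = 0 ->
    (forall p, prime p -> (p %| #|H|)%N -> (\sum_(h in H) `|b h| < p)%N) ->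
  forall h, h \in H -> b h = 0.
Proof.
have [n] := ubnP #|H|; elim: n H b => // n IHn H b leHn b0 small.
have [/card_le1_trivg H1 | H_gt1] := leqP #|H| 1.
  move=> h; move: b0; rewrite H1 set1gE big_set1 phi1 mulr1 => /eqP.
  by rewrite intr_eq0 inE => /eqP ? /eqP ->.
have p_pr := pdiv_prime H_gt1; have pH := pdiv_dvd #|H|.
set p := pdiv _ in p_pr pH.
have [K sKH oK] := cyclic_subgroup_exists (dvdn_div pH).
have oH : #|H| = (p * #|K|)%N by rewrite oK mulnC divnK.
have [X trX X0] : exists2 X, transversal_of H K X &
     forall c, c \in X -> \sum_(k in K) (b (c * k)%g)%:~R * phi k = 0.
  have [//|[P [v [oP _ trP Pv]]]] := fiber_sum_cases p_pr sKH oH b0.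
  exists P => // c Pc.
  (* If all [p] cosets were nonempty, the weight would be at least [p]. An empty coset forces the
     common value [v] to be 0. *)
  have /exists_inP[c' Pc'] : [exists c' in P,
      (\sum_(k in K) `|b (c' * k)%g| == 0)%N].
    apply: contraLR (small p p_pr pH); rewrite negb_exists_in => /forall_inP Pn0.
    rewrite -leqNgt (sum_transversal sKH trP) -oP -sum1_card.
    by apply: leq_sum => c' /Pn0; rewrite lt0n.
  rewrite sum_nat_eq0 => /forall_inP c'0; rewrite Pv // -(Pv c') // big1 // => k Kk.
  by have := c'0 k Kk; rewrite absz_eq0 => /eqP->; rewrite mul0r.
move=> h /(transversalE sKH trX)[c [k [Xc Kk ->]]].
apply: (IHn K (fun k => b (c * k)%g)) => //; last 1 first.
- move=> q q_pr qK; apply: leq_ltn_trans (small q q_pr _).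
    exact: (leq_fiber_sum sKH trX (fun h => `|b h|%N)).
  by rewrite oH dvdn_mull.
- by rewrite -ltnS (leq_trans _ leHn) // ltnS oK ltn_Pdiv ?prime_gt1 ?cardG_gt0.
- exact: X0.
Qed.

Lemma vanishing_sum_odd_le9 H b :
    coprime 6 #|H| -> \sum_(h in H) (b h)%:~R * phi h = 0 ->
    odd (\sum_(h in H) `|b h|) -> (\sum_(h in H) `|b h| <= 9)%N ->
  exists Q : {group gT}, exists y : gT, exists e : bool,
    [/\ Q \subset H, #|Q| \in [:: 5; 7]%N, y \in H &
        forall h, h \in H -> b h = (-1) ^+ e * ((y^-1 * h)%g \in Q)%:R].
Proof.
have [n] := ubnP #|H|; elim: n H b => // n IHn H b leHn co6H b0 odd_b le_b9.
have prime_ge5 q : prime q -> (q %| #|H|)%N -> (5 <= q)%N.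
  move=> q_pr qH; have : coprime 6 q by apply: coprime_dvdr co6H.
  by case: q q_pr {qH} => [|[|[|[|[|q]]]]].
have [/card_le1_trivg H1 | H_gt1] := leqP #|H| 1.
  move: b0 odd_b; rewrite H1 set1gE !big_set1 phi1 mulr1 => /eqP.
  by rewrite intr_eq0 => /eqP->.
have p_pr := max_pdiv_prime H_gt1; have pH := max_pdiv_dvd #|H|.
have p_max := @max_pdiv_max #|H|.
set p := max_pdiv _ in p_pr pH p_max.
have [K sKH oK] := cyclic_subgroup_exists (dvdn_div pH).
have oH : #|H| = (p * #|K|)%N by rewrite oK mulnC divnK.
have dvdKH q : (q %| #|K|)%N -> (q %| #|H|)%N by rewrite oH => /dvdn_mull->.
pose w c := (\sum_(k in K) `|b (c * k)%g|)%N.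
(* Stated for any transversal, since it serves both when [p] divides [#|K|] and when the common
   value [v] is 0. *)
have zero_case X : transversal_of H K X ->
    (forall c, c \in X -> \sum_(k in K) (b (c * k)%g)%:~R * phi k = 0) ->
    exists Q : {group gT}, exists y : gT, exists e : bool,
    [/\ Q \subset H, #|Q| \in [:: 5; 7]%N, y \in H &
        forall h, h \in H -> b h = (-1) ^+ e * ((y^-1 * h)%g \in Q)%:R].
  move=> trX X0; have wE := sum_transversal sKH trX (fun h => `|b h|%N).
  have light c : c \in X -> (w c < 5)%N -> forall k, k \in K -> b (c * k)%g = 0.
    move=> Xc wc5; apply: (vanishing_sum_small (b := fun k => b (c * k)%g)).
      exact: X0.
    by move=> q q_pr /dvdKH qH; apply: leq_trans wc5 (prime_ge5 q q_pr qH).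
  have [c0 Xc0 odd_c0] : exists2 c0, c0 \in X & odd (w c0).
    by apply: sum_nat_odd_exists; rewrite -wE.
  have w0_ge5 : (5 <= w c0)%N.
    rewrite leqNgt; apply: contraL odd_c0 => /(light c0 Xc0) c00.
    by rewrite /w big1 // => k Kk; rewrite c00.
  have [|||Q [y [e [sQK oQ Ky bE]]]] :=
    IHn K (fun k => b (c0 * k)%g) _ _ (X0 _ Xc0) odd_c0.
  - by rewrite -ltnS (leq_trans _ leHn) // ltnS oK ltn_Pdiv ?prime_gt1 ?cardG_gt0.
  - by apply: coprime_dvdr co6H; rewrite oH dvdn_mull.
  - exact: leq_trans (leq_fiber_sum sKH trX (fun h => `|b h|%N) Xc0) le_b9.
  have [/subsetP sXH _ injX] := trX.
  exists Q, (c0 * y)%g, e; split=> //; first exact: subset_trans sKH.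
    by apply: groupM; [apply: sXH | apply: (subsetP sKH)].
  move=> h /(transversalE sKH trX)[c [k [Xc Kk ->]]].
  have [-> | cc0] := eqVneq c c0.
    by rewrite bE // invMg -!mulgA mulKg.
  (* The coset of [c0] already has weight at least 5 out of 9, leaving at most 4 for this one. *)
  rewrite light //; last first.
    have : (w c0 + w c <= 9)%N.
      apply: leq_trans le_b9; rewrite wE (bigD1 c0) //= leq_add2l.
      by rewrite (bigD1 c) ?Xc ?cc0 //= leq_addr.
    move=> le9; rewrite ltnS -(leq_add2l 5).
    by apply: leq_trans le9; rewrite leq_add2r.
  case: (boolP (_ \in Q)) => [/(subsetP sQK)|]; rewrite ?mulr0 //.
  rewrite mulgA groupMr // invMg -mulgA groupMl ?groupV // => /(injX _ _ Xc0 Xc) c0c.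
  by rewrite c0c eqxx in cc0.
have [[X trX X0] | [P [v [oP pK trP Pv]]]] := fiber_sum_cases p_pr sKH oH b0.
  exact: zero_case trX X0.
have [v0 | v_neq0] := eqVneq v 0.
  by apply: zero_case trP _ => c /Pv ->.
have p_ge5 : (5 <= p)%N by apply: prime_ge5.
have wE : (\sum_(h in H) `|b h|)%N = (\sum_(c in P) w c)%N.
  exact: sum_transversal sKH trP _.
have w_gt0 c : c \in P -> (0 < w c)%N.
  move=> Pc; rewrite lt0n; apply: contra v_neq0 => wc0; rewrite -(Pv c Pc).
  rewrite big1 // => k Kk; move: wc0; rewrite sum_nat_eq0 => /forall_inP/(_ k Kk).
  by rewrite absz_eq0 => /eqP->; rewrite mul0r.
(* The other [p - 1] cosets each have weight at least 1. *)
have w_le c : c \in P -> (w c + p <= 10)%N.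
  move=> Pc; move: le_b9; rewrite wE (bigD1 c) //= => le9.
  suff : (w c + p.-1 <= 9)%N by move: p_ge5; lia.
  apply: leq_trans le9; rewrite leq_add2l -oP (cardsD1 c) Pc /= -sum1_card.
  rewrite (eq_bigl (fun i => (i \in P) && (i != c))); last first.
    by move=> i; rewrite !inE andbC.
  by apply: leq_sum => i /andP[Pi _]; apply: w_gt0.
(* Otherwise the total would be at least [2 * p], hence at least 10. *)
have [c1 Pc1 w1] : exists2 c1, c1 \in P & w c1 = 1%N.
  suff /exists_inP[c1 Pc1 /eqP w1] : [exists c1 in P, w c1 == 1%N] by exists c1.
  apply: contraLR le_b9 => /exists_inPn w_neq1.
  suff : (2 * p <= \sum_(h in H) `|b h|)%N by move: p_ge5; lia.
  rewrite wE mulnC -oP -sum_nat_const; apply: leq_sum => c Pc.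
  by have := w_gt0 c Pc; have := w_neq1 c Pc; case: (w c) => [|[]].
have fib_eq c k : c \in P -> k \in K -> b (c * k)%g = b (c1 * k)%g.
  move=> Pc Kk; apply/eqP; rewrite -subr_eq0; apply/eqP; move: k Kk.
  apply: (vanishing_sum_small (b := fun k => b (c * k)%g - b (c1 * k)%g)).
    under eq_bigr do rewrite rmorphB mulrBl.
    by rewrite sumrB !Pv // subrr.
  (* A prime [q] dividing [#|K|] is smaller than the maximal [p], so [p] is at least 7. Then [w c]
     is at most 3, and the difference of the two fibers has weight at most 4, less than [q]. *)
  move=> q q_pr qK; have q_ge5 := prime_ge5 q q_pr (dvdKH q qK).
  have q_lt_p : (q < p)%N.
    rewrite ltn_neqAle p_max ?mem_primes ?q_pr ?cardG_gt0 ?dvdKH // andbT.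
    by apply: contraNneq pK => <-.
  have p_ge7 : (7 <= p)%N.
    rewrite ltn_neqAle (leq_ltn_trans q_ge5 q_lt_p) andbT eq_sym.
    by apply: contraTneq p_pr => ->.
  apply: (@leq_ltn_trans (w c + w c1)).
    by rewrite /w -big_split /=; apply: leq_sum => k _; apply: leq_abszB.
  rewrite w1 addn1; apply: leq_trans q_ge5; rewrite !ltnS -(leq_add2r 7).
  by apply: leq_trans (w_le c Pc); rewrite leq_add2l.
have [k1 Kk1 [b1 b0']] := sum_nat_eq1_exists w1.
have [/subsetP sPH _ injP] := trP.
exists P, k1, (b (c1 * k1)%g < 0); split.
- exact/subsetP.
(* Weight 1 at [c1] gives [p <= 9], and the primes from 5 to 9 are 5 and 7. *)
- have := w_le c1 Pc1; rewrite w1 oP; move: p_pr p_ge5.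
  by case: (p) => [|[|[|[|[|[|[|[|[|[|]]]]]]]]]].
- exact: (subsetP sKH).
move=> h /(transversalE sKH trP)[c [k [Pc Kk ->]]].
rewrite fib_eq // (cT c) mulgA groupMr //.
have [-> | kk1] := eqVneq k k1.
  by rewrite mulVg group1 mulr1 {1}[b _]intEsign b1 mulr1.
have /eqP := b0' k Kk kk1; rewrite absz_eq0 => /eqP->.
case: (boolP (_ \in P)) => [Pk|]; rewrite ?mulr0 //.
have := injP _ _ (group1 P) Pk; rewrite invg1 mul1g groupM ?groupV // => /(_ isT)/eqP.
by rewrite eq_sym -eq_mulVg1 eq_sym (negbTE kk1).
Qed.

(** * Cancelling antipodal pairs: [tau] acts as -1 *)

Section Antipodes.

Variables (H : {group gT}) (tau : gT).
Hypotheses (tau2 : (tau * tau = 1)%g) (tauH : tau \notin H).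
Hypothesis oT : #|gT| = (2 * #|H|)%N.

Let tauV : (tau^-1)%g = tau.
Proof. by apply/eqP; rewrite eq_invg_mul tau2. Qed.

Let mem_tau h : ((tau * h)%g \in H) = (h \notin H).
Proof.
have [Hh | Hh] := boolP (h \in H); first by rewrite groupMr // (negbTE tauH).
have disjH : H :&: (tau *: H)%g = set0.
  apply/setP=> x; rewrite !inE mem_lcoset tauV.
  by case Hx: (x \in H) => //=; rewrite groupMr // (negbTE tauH).
have /setP/(_ h) : (H :|: (tau *: H)%g) = [set: gT].
  apply/eqP; rewrite eqEcard subsetT cardsU disjH cards0 subn0.
  by rewrite card_lcoset cardsT oT mul2n -addnn leqnn.
by rewrite !inE (negbTE Hh) /= mem_lcoset tauV.
Qed.

Let tauK h : (tau * (tau * h) = h)%g.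
Proof. by rewrite mulgA tau2 mul1g. Qed.

Let phi_tau : phi tau = -1.
Proof.
have /eqP := congr1 phi tau2; rewrite phiM phi1 -expr2 sqrf_eq1.
case/orP=> /eqP // phi_tau1; case/negP: tauH.
by rewrite (_ : tau = 1%g) //; apply: phi_inj; rewrite phi1.
Qed.

Lemma sum_antipodes (V : nmodType) (F : gT -> V) :
  \sum_h F h = \sum_(h in H) (F h + F (tau * h)%g).
Proof.
rewrite big_split [LHS](bigID (mem H)) /=; congr (_ + _).
rewrite (reindex_inj (mulgI tau)) /=; apply: eq_bigl => h.
by rewrite mem_tau negbK.
Qed.

Let sum_antipodes_nat (F : gT -> nat) :
  (\sum_h F h = \sum_(h in H) (F h + F (tau * h)%g))%N.
Proof. exact: (sum_antipodes (V := nat)). Qed.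

Variable c : gT -> nat.
Hypothesis c0 : \sum_h (c h)%:R * phi h = 0.

(* c is the sum of A and its translate by tau, plus the positive part of b on H
   and the negative part of b, translated by tau, off H. *)
Let b h : int := (c h)%:Z - (c (tau * h)%g)%:Z.
Let A h : nat := if h \in H then minn (c h) (c (tau * h)%g) else 0%N.

Let b0 : \sum_(h in H) (b h)%:~R * phi h = 0.
Proof.
rewrite -[RHS]c0 sum_antipodes; apply: eq_bigr => h _.
by rewrite phiM phi_tau rmorphB /= mulrBl mulN1r mulrN.
Qed.

(** Hence the weight of [b] has the parity of the total multiplicity and does not exceed it. *)
Let sum_c : (\sum_h c h = \sum_(h in H) `|b h| + 2 * \sum_h A h)%N.
Proof.
rewrite !sum_antipodes_nat big_distrr -big_split /=.
by apply: eq_bigr => h Hh; rewrite /A Hh mem_tau Hh addn0 -addn_absz_minn.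
Qed.

(** An odd weight is nonzero, so it cannot lie below every prime divisor of [#|H|]. For trivial [H]
    that bound would hold vacuously, which excludes this case too. *)
Lemma odd_vanishing_sum_pdiv : odd (\sum_h c h) ->
  (1 < #|H|)%N && (pdiv #|H| <= \sum_h c h)%N.
Proof.
rewrite sum_c oddD oddM addbF => odd_w; set w := (\sum_(h in H) _)%N in odd_w *.
have not_small : ~ forall p, prime p -> (p %| #|H|)%N -> (w < p)%N.
  move=> /(vanishing_sum_small b0) bH; move: odd_w.
  by rewrite /w big1 // => h /bH ->.
have [H_le1 | H_gt1] := leqP #|H| 1.
  case: not_small => p p_pr; have -> : #|H| = 1%N.
    by apply/eqP; rewrite eqn_leq H_le1 cardG_gt0.
  by rewrite dvdn1 => /eqP p1; rewrite p1 in p_pr.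
apply: leq_trans (leq_addr _ _); rewrite leqNgt; apply/negP=> w_lt.
case: not_small => p p_pr pH.
by apply: leq_trans w_lt (pdiv_min_dvd (prime_gt1 p_pr) pH).
Qed.

(** [b] is up to sign the indicator of a coset of [Q]. Its weight 5 or 7 leaves 4 or 2 in antipodal
    pairs, so [A] has 2 points or 1, each contributing a translate of [D_ gT 2]. *)
Lemma vanishing_sum_weight9 : coprime 6 #|H| -> (\sum_h c h = 9)%N ->
  ((5 %| #|H|)%N /\ exists h1 h2 h3 : gT, forall k, (c k)%:Z =
     (D_ gT 2 * (gr_elt h1 + gr_elt h2) + D_ gT 5 * gr_elt h3) k) \/
  ((7 %| #|H|)%N /\ exists h1 h2 : gT, forall k, (c k)%:Z =
     (D_ gT 2 * gr_elt h1 + D_ gT 7 * gr_elt h2) k).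
Proof.
move=> co6H c9; have wA := sum_c; rewrite c9 in wA.
have odd_w : odd (\sum_(h in H) `|b h|).
  by have := congr1 odd wA; rewrite oddD oddM addbF.
have le_w9 : (\sum_(h in H) `|b h| <= 9)%N by rewrite wA leq_addr.
have [Q [y [e [sQH oQ Hy bE]]]] := vanishing_sum_odd_le9 co6H b0 odd_w le_w9.
have wQ : (\sum_(h in H) `|b h| = #|Q|)%N.
  rewrite -sum1_card [RHS](reindex_inj (mulgI y^-1%g)) /=.
  transitivity (\sum_(h in H | (y^-1 * h)%g \in Q) 1)%N.
    rewrite big_mkcondr /=; apply: eq_bigr => h Hh.
    by rewrite bE // abszM absz_sign mul1n; case: (_ \in Q).
  apply: eq_bigl => h; apply: andb_idl => /(subsetP sQH).
  by rewrite groupMl ?groupV.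
have dvdQ : (#|Q| %| #|gT|)%N by rewrite -cardsT cardSg ?subsetT.
have DE k h : (D_ gT #|Q| * gr_elt h) k = ((k * h^-1)%g \in Q)%:R.
  rewrite gr_mul_eltE D_E (_ : subgroup_of_order gT #|Q| = Q) //.
  by apply/esym/eqP; rewrite -subgroup_of_orderP.
have D2E k h : (D_ gT 2 * gr_elt h) k = ((k == h) + ((tau * k)%g == h))%N%:Z.
  have tau1 : tau != 1%g by apply: contraNneq tauH => ->.
  have otau : #[tau]%g = 2%N by apply: nt_prime_order; rewrite ?expgS ?expg1.
  rewrite gr_mul_eltE D_E (_ : subgroup_of_order gT 2 = <[tau]>%G); last first.
    apply/esym/eqP; rewrite -subgroup_of_orderP // ?oT ?dvdn_mulr //.
    by rewrite -orderE otau.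
  have -> : ((k * h^-1)%g \in <[tau]>%g) = (k == h) || ((tau * k)%g == h).
    rewrite cycle2g // !inE -eq_mulgV1; congr (_ || _).
    by rewrite -(inj_eq (mulgI tau)) tau2 mulgA -eq_mulgV1.
  case: eqP => [->|_]; case: eqP => //.
  by move/eqP; rewrite -{2}[h]mul1g (inj_eq (mulIg h)) (negbTE tau1).
(* A negative sign of [b] means that the unpaired coset lies in the translate of [H] by [tau], hence
   the factor [tau ^+ e]. *)
have cE k : c k = (A k + A (tau * k)%g + ((k * (tau ^+ e * y)^-1)%g \in Q))%N.
  have kyE : (k * (tau ^+ e * y)^-1 = y^-1 * (tau ^+ e * k))%g.
    rewrite invMg [LHS]cT -mulgA; congr (_ * (_ * _))%g.
    by case: (e); rewrite ?expg1 ?tauV // invg1.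
  have memQ h : (y^-1 * h)%g \in Q -> h \in H.
    by move/(subsetP sQH); rewrite groupMl ?groupV.
  rewrite kyE /A mem_tau tauK; have [Hk | Hk] := boolP (k \in H).
    have := bE k Hk; rewrite /b /= addn0.
    case: e {bE kyE} => /=; last first.
      by rewrite expg0 mul1g expr0 mul1r; apply: minn_pos_l.
    rewrite expr1 expg1 (_ : (_ * (tau * k))%g \in Q = false).
      by rewrite addn0; apply: minn_neg_l.
    by apply: contraTF Hk => /memQ; rewrite mem_tau.
  have := bE (tau * k)%g; rewrite mem_tau => /(_ Hk); rewrite /b /= add0n tauK.
  case: e {bE kyE} => /=.
    by rewrite expr1 expg1; apply: minn_neg_r.
  rewrite expg0 mul1g expr0 mul1r (_ : (_ * k)%g \in Q = false).
    by rewrite addn0; apply: minn_pos_r.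
  by apply: contraNF Hk => /memQ.
rewrite wQ in wA; move: oQ; rewrite !inE => /orP[]/eqP oQ; [left | right].
  have [h1 [A1 [sumA1 AE]]] : exists h1 A1, (\sum_h A1 h = 1)%N /\
      forall h, A h = ((h == h1) + A1 h)%N.
    by apply: sum_nat_succ; move: wA; rewrite oQ; clear; lia.
  have [h2 [A2 [sumA2 A1E]]] := sum_nat_succ sumA1.
  have {}A2E h : A2 h = 0%N.
    by move/eqP: sumA2; rewrite sum_nat_eq0 => /forallP/(_ h)/eqP.
  split; first by rewrite -oQ cardSg.
  exists h1, h2, (tau ^+ e * y)%g => k; rewrite ffunE mulrDr ffunE !D2E -oQ DE.
  by rewrite cE !AE !A1E !A2E; do 4!case: (_ == _); case: (_ \in Q).
have [h1 [A1 [sumA1 AE]]] : exists h1 A1, (\sum_h A1 h = 0)%N /\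
    forall h, A h = ((h == h1) + A1 h)%N.
  by apply: sum_nat_succ; move: wA; rewrite oQ; clear; lia.
have {}A1E h : A1 h = 0%N.
  by move/eqP: sumA1; rewrite sum_nat_eq0 => /forallP/(_ h)/eqP.
split; first by rewrite -oQ cardSg.
exists h1, (tau ^+ e * y)%g => k; rewrite ffunE D2E -oQ DE.
by rewrite cE !AE !A1E; do 2!case: (_ == _); case: (_ \in Q).
Qed.

End Antipodes.
End VanishingSums.

(** * From bent functions to vanishing sums *)

(** The autocorrelation [C] has the squared moduli of the character sums as its Fourier transform.
    Bentness makes this transform constant, so [C] is supported at 0. *)
Lemma generalized_bent_autocorrelation (G : finZmodType) (m : nat) (zeta : algC)
    (f : G -> 'Z_m) :
    m.-primitive_root zeta -> (1 < m)%N -> generalized_bent zeta f ->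
  forall x, x != 0 -> \sum_(y : G) zeta ^+ (f (x + y) - f y)%R = 0.
Proof.
move=> zeta_prim m_gt1 f_bent.
pose C x := \sum_(y : G) zeta ^+ f (x + y) * (zeta ^+ f y)^*.
have zeta_neq0 : zeta != 0.
  apply: contra_eq_neq (prim_expr_order zeta_prim) => ->.
  by rewrite expr0n gtn_eqF 1?ltnW // eq_sym oner_eq0.
have zetaC k : (zeta ^+ k)^* = (zeta ^+ k)^-1.
  rewrite -[RHS]mul1r; apply: (canRL (mulfK (expf_neq0 k zeta_neq0))).
  rewrite mulrC -normCK normrX -exprM.
  have -> : `|zeta| = 1.
    apply/eqP; rewrite -(pexpr_eq1 (n := m)) ?normr_ge0 1?ltnW //.
    by rewrite -normrX (prim_expr_order zeta_prim) normr1.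
  by rewrite expr1n.
have zetaD (a b : 'Z_m) : zeta ^+ (a + b)%R = zeta ^+ a * zeta ^+ b.
  by rewrite -exprD /= [X in (_ %% X)%N]Zp_cast // (prim_expr_mod zeta_prim).
suff C0 x : x != 0 -> C x = 0.
  move=> x x0; rewrite -[RHS](C0 x x0); apply: eq_bigr => y _.
  apply: (mulIf (expf_neq0 (f y) zeta_neq0)).
  rewrite zetaC mulfVK ?expf_neq0 //.
  by rewrite -zetaD subrK.
have cGG : abelian [set: G].
  by apply/centsP => a _ b _; apply: addrC.
have lin := char_abelianP _ cGG.
have CF (i : Iirr [set: G]) : \sum_x C x * 'chi_i x = #|G|%:R.
  rewrite -(f_bent _ (lin i)) normCK rmorph_sum mulr_sumr /C.
  under eq_bigr do rewrite mulr_suml.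
  rewrite exchange_big /=; apply: eq_bigr => y _.
  rewrite rmorphM /= mulr_suml [RHS](reindex_inj (addIr y)) /=.
  apply: eq_bigr => u _; rewrite (lin_charM (lin i)) ?inE //.
  rewrite -[LHS]mulr1 -(expr1n _ 2) -(normC_lin_char (lin i) (in_setT y)) normCK.
  by rewrite -!mulrA; congr (_ * _); rewrite mulrCA; congr (_ * _); rewrite mulrCA.
move=> z0; apply: (mulfI (x := #|G|%:R)).
  by rewrite pnatr_eq0 -lt0n; apply/card_gt0P; exists 0.
rewrite mulr0.
(* Column orthogonality inverts the transform at [x]; below, constancy of the transform reduces it
   to the orthogonality of the columns of 0 and [x]. *)
transitivity (\sum_(i : Iirr [set: G]) (\sum_y C y * 'chi_i y) * ('chi_i x)^*).
  under [RHS]eq_bigr do rewrite mulr_suml.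
  rewrite exchange_big /= (bigD1 x) //= [X in _ + X]big1 ?addr0.
    under [RHS]eq_bigr do rewrite -mulrA.
    rewrite -mulr_sumr second_orthogonality_relation ?inE // class_refl mulr1n mulrC.
    have -> : 'C_[set: G][x]%g = [set: G].
      by apply/setIidPl; rewrite sub_cent1 (subsetP cGG) ?inE.
    by rewrite cardsT.
  move=> y yx; under eq_bigr do rewrite -mulrA.
  rewrite -mulr_sumr second_orthogonality_relation ?inE //.
  by rewrite (abelian_classP _ cGG) ?inE // (negbTE yx) mulr0n mulr0.
transitivity (\sum_(i : Iirr [set: G]) #|G|%:R * ('chi_i 1%g * ('chi_i x)^*)).
  by apply: eq_bigr => i _; rewrite CF (lin_char1 (lin i)) mul1r.
rewrite -mulr_sumr second_orthogonality_relation ?inE //.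
by rewrite (abelian_classP _ cGG) ?inE // eq_sym (negbTE z0) mulr0n mulr0.
Qed.

Lemma cycle_faithful_character (gT : finGroupType) (g : gT) (zeta : algC) :
    [set: gT] = <[g]>%g -> #[g]%g.-primitive_root zeta ->
  exists phi : gT -> algC,
    [/\ phi 1%g = 1, {morph phi : x y / (x * y)%g >-> x * y}, injective phi &
        forall i, phi (g ^+ i)%g = zeta ^+ i].
Proof.
move=> defT zeta_prim.
have gE h : exists i, h = (g ^+ i)%g.
  by have /cycleP[i ->] : h \in <[g]>%g; [rewrite -defT inE | exists i].
(* A discrete logarithm to base [g]; writing the order as a successor makes the default [ord0]
   available. *)
pose phi h := zeta ^+ odflt ord0 [pick i : 'I_#[g]%g.-1.+1 | h == (g ^+ i)%g].
have phiE i : phi (g ^+ i)%g = zeta ^+ i.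
  rewrite /phi; case: pickP => [j|]; rewrite /=.
    rewrite eq_expg_mod_order => /eqP ij; apply/eqP.
    by rewrite (eq_prim_root_expr zeta_prim) ij.
  have lt_i : (i %% #[g]%g < #[g]%g.-1.+1)%N by rewrite prednK ?ltn_mod ?order_gt0.
  by move/(_ (Ordinal lt_i)); rewrite /= expg_mod_order eqxx.
exists phi; split=> //; first exact: phiE 0%N.
  by move=> x y; have [[i ->] [j ->]] := (gE x, gE y); rewrite -expgD !phiE exprD.
move=> x y; have [[i ->] [j ->]] := (gE x, gE y); rewrite !phiE => /eqP.
by rewrite (eq_prim_root_expr zeta_prim) -eq_expg_mod_order => /eqP.
Qed.

(** Take [tau] to be [g ^+ m]. If it lay in the subgroup of order [m], then [2 * m] would divide
    [m * m], against the oddness of [m]. *)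
Lemma even_cycle_split (gT : finGroupType) (g : gT) (m : nat) :
    [set: gT] = <[g]>%g -> #[g]%g = (2 * m)%N -> odd m ->
  exists (H : {group gT}) (tau : gT),
    [/\ #|H| = m, (tau * tau = 1)%g, tau \notin H & #|gT| = (2 * #|H|)%N].
Proof.
move=> defT og odd_m; have oT : #|gT| = (2 * m)%N by rewrite -cardsT defT -orderE.
have cycT : cyclic [set: gT] by apply/cyclicP; exists g.
have [|H _ oH] := cyclic_subgroup_exists cycT (H := [set: gT]%G) (d := m).
  by rewrite cardsT oT dvdn_mull.
exists H, (g ^+ m)%g; split; rewrite ?oH //.
  by rewrite -expgD addnn -mul2n -og expg_order.
apply/negP=> /expg_cardG/eqP; rewrite oH -expgM -order_dvdn og.
by rewrite dvdn_pmul2r ?odd_gt0 // dvdn2 odd_m.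
Qed.

(** [c k] counts the [y] whose term in [E_ g f x] is [k]. *)
Lemma E_count (gT : finGroupType) (g : gT) (phi : gT -> algC) (zeta : algC)
    (n m : nat) (f : 'rV['Z_3]_n -> 'Z_m) (x : 'rV['Z_3]_n) :
    (forall i, phi (g ^+ i)%g = zeta ^+ i) ->
    \sum_y zeta ^+ (f (x + y) - f y)%R = 0 ->
  exists c : gT -> nat, [/\ forall k, E_ g f x k = (c k)%:Z,
    (\sum_k c k = 3 ^ n)%N & \sum_k (c k)%:R * phi k = 0].
Proof.
move=> phiE f0; pose h y := (g ^+ (f (x + y) - f y)%R)%g.
exists (fun k => \sum_y (k == h y))%N; split=> [k||].
- rewrite /E_ sum_ffunE (big_morph Posz PoszD (erefl _)).
  by apply: eq_bigr => y _; rewrite ffunE; case: eqP.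
- rewrite exchange_big /= (eq_bigr (fun=> 1%N)); last first.
    by move=> y _; rewrite (bigD1 (h y)) //= eqxx big1 // => k /negbTE ->.
  by rewrite sum1_card card_mx card_ord mul1n.
- rewrite -[RHS]f0; under eq_bigr do rewrite natr_sum mulr_suml.
  rewrite exchange_big; apply: eq_bigr => y _ /=; rewrite (bigD1 (h y)) //= eqxx mul1r.
  by rewrite phiE big1 ?addr0 // => k /negbTE ->; rewrite mul0r.
Qed.

(** * The bound on the least prime and the forms for dimension two *)

Theorem lemma4p2 (n t m' : nat) (p alpha : nat -> nat) (zeta : algC)
    (f : 'rV['Z_3]_n -> 'Z_(2 * m'))
    (n_gt0 : (0 < n)%N)
    (p_prime : forall j : nat, (1 <= j <= t)%N -> prime (p j))
    (p_ge5 : forall j : nat, (1 <= j <= t)%N -> (5 <= p j)%N)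
    (p_incr : forall i j : nat, (1 <= i)%N -> (i < j)%N -> (j <= t)%N ->
       (p i < p j)%N)
    (alpha_gt0 : forall j : nat, (1 <= j <= t)%N -> (0 < alpha j)%N)
    (m'E : m' = (\prod_(1 <= j < t.+1) p j ^ alpha j)%N)
    (zeta_prim : (2 * m').-primitive_root zeta)
    (f_bent : generalized_bent zeta f) :
  [/\ (1 <= t)%N,
      (p 1 + 2 <= 3 ^ n)%N
    & n = 2%N ->
      forall (gT : finGroupType) (g : gT),
        [set: gT] = <[g]>%g -> #[g]%g = (2 * m')%N ->
      forall x : 'rV['Z_3]_n, x != 0 ->
        ((5 %| 2 * m')%N /\
         exists h1 h2 h3 : gT,
           E_ g f x = D_ gT 2 * (gr_elt h1 + gr_elt h2) + D_ gT 5 * gr_elt h3)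
        \/
        ((7 %| 2 * m')%N /\
         exists h1 h2 : gT,
           E_ g f x = D_ gT 2 * gr_elt h1 + D_ gT 7 * gr_elt h2)].
Proof.
have m'_gt0 : (0 < m')%N.
  by have := prim_order_gt0 zeta_prim; rewrite muln_gt0.
have m_gt1 : (1 < 2 * m')%N by rewrite mul2n -addnn (leq_add m'_gt0 m'_gt0).
have f0 := generalized_bent_autocorrelation zeta_prim m_gt1 f_bent.
have m'_pdiv q : prime q -> (q %| m')%N -> exists2 j, (1 <= j <= t)%N & q = p j.
  move=> q_pr; rewrite m'E big_nat_cond.
  elim/big_ind: _ => [|u v IHu IHv|j].
  - by rewrite dvdn1 => /eqP q1; rewrite q1 in q_pr.
  - by rewrite Euclid_dvdM // => /orP[/IHu|/IHv].
  - rewrite andbT ltnS => jt; rewrite Euclid_dvdX // => /andP[qp _]; exists j => //.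
    by apply/eqP; rewrite -dvdn_prime2 ?p_prime.
have co6 : coprime 6 m'.
  rewrite -[6%N]/(2 * 3)%N coprimeMl !prime_coprime //.
  by apply/andP; split; apply/negP=> /m'_pdiv[] // j /p_ge5 + pj; rewrite -pj.
have odd_m' : odd m'.
  by move: co6; rewrite -[6%N]/(2 * 3)%N coprimeMl coprime2n => /andP[].
have [t_ge1 p1_le] : (1 <= t)%N /\ (p 1 <= 3 ^ n)%N.
  (* The first two claims mention no group, so the additive group of integers mod [2 * m'] serves as
     the cyclic group. *)
  have Zm := Zp_cast m_gt1; pose g : 'Z_(2 * m') := Zp1.
  have defT : [set: 'Z_(2 * m')] = <[g]>%g by apply: Zp_cycle.
  have og : #[g]%g = (2 * m')%N by rewrite order_Zp1.
  have zeta_g : #[g]%g.-primitive_root zeta by rewrite og.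
  have [phi [phi1 phiM phi_inj phiE]] := cycle_faithful_character defT zeta_g.
  have [H [tau [oH tau2 tauH oT]]] := even_cycle_split defT og odd_m'.
  (* Any nonzero [x] would do; one exists because [n] is positive. *)
  have x0 : const_mx 1 != 0 :> 'rV['Z_3]_n.
    by apply/eqP=> /matrixP/(_ ord0 (Ordinal n_gt0)); rewrite !mxE.
  have [c [_ sum_c c0]] := E_count phiE (f0 _ x0).
  have cycT : cyclic [set: 'Z_(2 * m')] by apply/cyclicP; exists g.
  have := odd_vanishing_sum_pdiv cycT phi1 phiM phi_inj tau2 tauH oT c0.
  rewrite sum_c oddX orbT oH => /(_ isT)/andP[m'_gt1 le_pdiv].
  have [j /andP[j1 jt] pj] := m'_pdiv _ (pdiv_prime m'_gt1) (pdiv_dvd m').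
  split; first exact: leq_trans jt.
  apply: leq_trans le_pdiv; rewrite pj.
  by move: j1; rewrite leq_eqVlt => /predU1P[<- // | j1]; apply/ltnW/p_incr.
split=> //.
  have p1_pr : prime (p 1) by apply: p_prime; rewrite t_ge1.
  have p1_ge5 : (5 <= p 1)%N by apply: p_ge5; rewrite t_ge1.
  have odd_p1 : odd (p 1) by case: (even_prime p1_pr) p1_ge5 => // ->.
  (* [p 1] is not a power of 3, and [p 1] and [3 ^ n] are both odd, so the gap is at least 2. *)
  have p1_neq : p 1 != (3 ^ n)%N.
    apply: contraTneq p1_ge5 => p1E; suff <- : 3 = p 1 by [].
    by apply/eqP; rewrite -dvdn_prime2 // p1E dvdn_exp.
  rewrite addn2 ltn_neqAle [X in _ && X]ltn_neqAle p1_neq p1_le !andbT.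
  by apply: contraTneq odd_p1 => /(congr1 odd); rewrite /= oddX orbT.
move=> n2 gT g defT og x x0.
have zeta_g : #[g]%g.-primitive_root zeta by rewrite og.
have [phi [phi1 phiM phi_inj phiE]] := cycle_faithful_character defT zeta_g.
have [H [tau [oH tau2 tauH oT]]] := even_cycle_split defT og odd_m'.
have [c [cE sum_c c0]] := E_count phiE (f0 _ x0).
have cycT : cyclic [set: gT] by apply/cyclicP; exists g.
have c9 : (\sum_k c k = 9)%N by rewrite sum_c n2.
have := vanishing_sum_weight9 cycT phi1 phiM phi_inj tau2 tauH oT c0.
rewrite oH => /(_ co6 c9)[[dv [h1 [h2 [h3 EE]]]] | [dv [h1 [h2 EE]]]].
  left; split; first exact: dvdn_mull.
  by exists h1, h2, h3; apply/ffunP=> k; rewrite cE EE.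
right; split; first exact: dvdn_mull.
by exists h1, h2; apply/ffunP=> k; rewrite cE EE.
Qed.
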